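(* Let $n\geq 4$. Among all $n$-vertex unicyclic graphs, the graph $U_1$ has the minimal total-eccentricity index; that is, $\tau(U_1)\leq \tau(U)$ for every $n$-vertex unicyclic graph $U$.
   Context: All graphs are finite and simple. For a connected graph $G$, the eccentricity $e_G(v)$ of a vertex $v$ is the largest distance from $v$ to any other vertex of $G$. The total-eccentricity index of $G$ is $\tau(G)=\sum_{u\in V(G)} e_G(u)$. An $n$-vertex unicyclic graph is a connected graph with $n$ vertices and exactly $n$ edges. $U_1$ is the $n$-vertex unicyclic graph obtained from the star on $n$ vertices (one vertex of degree $n-1$ and $n-1$ vertices of degree $1$) by adding one edge between two of its pendant vertices. *)

(* Defs.v *)
From mathcomp Require Import all_boot.
Set Implicit Arguments.
Unset Strict Implicit.
Unset Printing Implicit Defensive.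

Record sgraph (T : finType) := SGraph {
  adj :> rel T;
  adj_sym : symmetric adj;
  adj_irr : irreflexive adj }.

Section Graph.
Variables (T : finType) (G : sgraph T).

Definition edges : {set {set T}} := [set [set x; y] | x in T, y in T & G x y].

Definition connected : bool := [forall x, forall y, connect G x y].

Definition walk (k : nat) (x y : T) : bool :=
  [exists p : k.-tuple T, path G x p && (last x p == y)].

(* Length of a shortest walk from x to y. A shortest walk repeats no vertex,
   so lengths below #|T| suffice; the value is #|T| if y is not reachable
   from x, which never happens in a connected graph. *)
Definition dist (x y : T) : nat := find (fun k => walk k x y) (iota 0 #|T|).

Definition ecc (x : T) : nat := \max_(y | y != x) dist x y.

Definition total_ecc : nat := \sum_x ecc x.

Definition unicyclic (n : nat) : bool :=
  [&& #|T| == n, connected & #|edges| == n].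

End Graph.

Section Star.
Variable T : finType.

Definition star_adj (c : T) : rel T :=
  fun x y => (x != y) && ((x == c) || (y == c)).

Lemma star_adj_sym c : symmetric (star_adj c).
Proof. by move=> x y; rewrite /star_adj eq_sym orbC. Qed.

Lemma star_adj_irr c : irreflexive (star_adj c).
Proof. by move=> x; rewrite /star_adj eqxx. Qed.

Definition star (c : T) : sgraph T := SGraph (star_adj_sym c) (star_adj_irr c).

(* The guard x != y only matters for a = b, where it prevents a loop. *)
Definition add_edge_adj (G : sgraph T) (a b : T) : rel T :=
  fun x y => G x y ||
    [&& x != y & ((x == a) && (y == b)) || ((x == b) && (y == a))].

Lemma add_edge_adj_sym G a b : symmetric (add_edge_adj G a b).
Proof.
move=> x y; rewrite /add_edge_adj adj_sym eq_sym.
by rewrite orbC [X in _ && X]orbC [(x == b) && _]andbC [(x == a) && _]andbC orbC.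
Qed.

Lemma add_edge_adj_irr G a b : irreflexive (add_edge_adj G a b).
Proof. by move=> x; rewrite /add_edge_adj adj_irr eqxx. Qed.

Definition add_edge (G : sgraph T) (a b : T) : sgraph T :=
  SGraph (add_edge_adj_sym G a b) (add_edge_adj_irr G a b).

(* Intended for pairwise distinct c, a and b: the pendant vertices of star c
   are then exactly the vertices other than c. *)
Definition U1 (c a b : T) : sgraph T := add_edge (star c) a b.

End Star.

(* Main.v *)
Require Import Defs.
From mathcomp Require Import all_boot.
From mathcomp Require Import zify.

(** In a graph on [n >= 4] vertices every eccentricity is at least 1, and a
    vertex of eccentricity 1 is adjacent to all the others
    ([adj_of_ecc_le1]).  Two such vertices would already account for
    [(n - 1) + (n - 2) > n] edges ([card_edges_two_universal]), so a graph with
    [n] edges has at most one of them, and its total eccentricity is at least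
    [1 + 2 (n - 1)] ([total_ecc_lower]).  In [U1 c a b] the vertex [c] reaches
    every other vertex in one step, hence two distinct vertices are adjacent or
    joined by a walk of length 2 through [c]: [U1 c a b] attains the bound
    ([total_ecc_U1]). *)

Section Distance.
Set Implicit Arguments.
Unset Strict Implicit.
Variables (T : finType) (G : sgraph T).

Lemma dist_le k x y : k < #|T| -> walk G k x y -> dist G x y <= k.
Proof.
move=> ltkT wk; rewrite /dist leqNgt; apply/negP => /(before_find 0).
by rewrite nth_iota // add0n wk.
Qed.

Lemma walk_dist x y : dist G x y < #|T| -> walk G (dist G x y) x y.
Proof.
rewrite /dist => lt_dT; set P := fun k => walk G k x y.
have hasP : has P (iota 0 #|T|) by rewrite has_find size_iota.
by have := nth_find 0 hasP; rewrite nth_iota // add0n.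
Qed.

Lemma walk0 x y : walk G 0 x y -> x = y.
Proof. by case/existsP=> p; rewrite tuple0 /= => /eqP. Qed.

Lemma walk1 x y : walk G 1 x y = G x y.
Proof.
apply/existsP/idP => [[p]|Gxy]; last by exists [tuple y]; rewrite /= Gxy eqxx.
by case/tupleP: p => z p; rewrite tuple0 /= andbT => /andP[Gxz /eqP <-].
Qed.

Lemma walk2 x z y : G x z -> G z y -> walk G 2 x y.
Proof. by move=> Gxz Gzy; apply/existsP; exists [tuple z; y]; rewrite /= Gxz Gzy eqxx. Qed.

Lemma dist_gt0 x y : x != y -> 0 < dist G x y.
Proof.
move=> neq_xy; rewrite lt0n; apply/eqP => d0.
have T_gt0 : 0 < #|T| by apply/card_gt0P; exists x.
have := @walk_dist x y; rewrite d0 => /(_ T_gt0) /walk0 eq_xy.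
by rewrite eq_xy eqxx in neq_xy.
Qed.

Lemma dist_le1_adj x y : 1 < #|T| -> x != y -> dist G x y <= 1 -> G x y.
Proof.
move=> T_gt1 neq_xy le_d1.
have d1 : dist G x y = 1 by apply/eqP; rewrite eqn_leq le_d1 dist_gt0.
by rewrite -walk1 -d1 walk_dist // d1.
Qed.

Lemma dist_le_ecc x y : y != x -> dist G x y <= ecc G x.
Proof. by move=> neq_yx; apply: (leq_bigmax_cond (F := dist G x)). Qed.

Lemma ecc_gt0 x : 1 < #|T| -> 0 < ecc G x.
Proof.
move=> T_gt1.
have /card_gt0P[y] : 0 < #|predC1 x| by move: (cardC1 x); lia.
rewrite !inE => neq_yx; apply: leq_trans (dist_le_ecc neq_yx).
by rewrite dist_gt0 // eq_sym.
Qed.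

Lemma adj_of_ecc_le1 x y : 1 < #|T| -> ecc G x <= 1 -> y != x -> G x y.
Proof.
move=> T_gt1 le_e1 neq_yx; apply: dist_le1_adj => //; first by rewrite eq_sym.
exact: leq_trans (dist_le_ecc neq_yx) le_e1.
Qed.

End Distance.

Section Edges.
Set Implicit Arguments.
Unset Strict Implicit.
Variable T : finType.

Lemma mem_edges (G : sgraph T) x y : G x y -> [set x; y] \in edges G.
Proof. by move=> Gxy; apply/imset2P; exists x y; rewrite ?inE. Qed.

Lemma edgesP (G : sgraph T) (e : {set T}) :
  reflect (exists x y, G x y /\ e = [set x; y]) (e \in edges G).
Proof.
apply: (iffP imset2P) => [[x y _]|[x [y [Gxy ->]]]].
  by rewrite inE => /andP[_ Gxy] ->; exists x, y.
by exists x y; rewrite ?inE.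
Qed.

Lemma card_star_edges (u : T) (A : {set T}) :
  u \notin A -> #|[set [set u; y] | y in A]| = #|A|.
Proof.
move=> uA; apply: card_in_imset => y z yA _ /setP/(_ y).
rewrite !inE eqxx orbT => /esym/orP[/eqP yu|/eqP //].
by rewrite yu (negPf uA) in yA.
Qed.

(** The edges at [u], together with the edges at [v] that avoid [u], are
    pairwise distinct. *)
Lemma card_edges_two_universal (G : sgraph T) (u v : T) :
  u != v -> (forall y, y != u -> G u y) -> (forall y, y != v -> G v y) ->
  2 * #|T| - 3 <= #|edges G|.
Proof.
move=> neq_uv Gu Gv.
set Eu := [set [set u; y] | y in [set~ u]].
set Ev := [set [set v; y] | y in ~: [set u; v]].
have cEu : #|Eu| = #|T| - 1.
  by rewrite card_star_edges ?inE ?eqxx // cardsC1 subn1.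
have cEv : #|Ev| = #|T| - 2.
  by rewrite card_star_edges ?inE ?eqxx ?orbT // cardsCs setCK cards2 neq_uv.
have disj : [disjoint Eu & Ev].
  apply/pred0P => e /=; apply/negbTE/negP => /andP[/imsetP[y _ ->]].
  case/imsetP=> z; rewrite !inE negb_or => /andP[neq_zu _] /setP/(_ u).
  by rewrite !inE eqxx (negPf neq_uv) [u == z]eq_sym (negPf neq_zu).
have sub : Eu :|: Ev \subset edges G.
  apply/subsetP => e; rewrite inE => /orP[] /imsetP[y].
    by rewrite !inE => neq_yu ->; apply/mem_edges/Gu.
  by rewrite !inE negb_or => /andP[_ neq_yv] ->; apply/mem_edges/Gv.
apply: leq_trans (subset_leq_card sub).
by rewrite cardsU disjoint_setI0 // cards0 cEu cEv; lia.
Qed.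

End Edges.

Lemma sum2_but_one (T : finType) (u : T) :
  1 + \sum_(x | x != u) 2 = 2 * #|T| - 1.
Proof.
have -> : 2 * #|T| = \sum_(x : T) 2 by rewrite sum_nat_const mulnC.
by rewrite [in RHS](bigD1 u) //= add2n subn1 add1n.
Qed.

(** Two vertices of eccentricity at most 1 would force [2 #|T| - 3] edges,
    which exceeds [#|T|] exactly when [4 <= #|T|]; all vertices but one thus
    contribute at least 2. *)
Lemma total_ecc_lower (T : finType) (G : sgraph T) :
  4 <= #|T| -> #|edges G| <= #|T| -> 2 * #|T| - 1 <= total_ecc G.
Proof.
move=> T_ge4 leE; have T_gt1 : 1 < #|T| by lia.
rewrite /total_ecc.
case: (pickP (fun u => ecc G u <= 1)) => [u eu | ecc_gt1].
  have sum2 : \sum_(x | x != u) 2 <= \sum_(x | x != u) ecc G x.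
    apply: leq_sum => v neq_vu; rewrite ltnNge; apply/negP => ev.
    rewrite eq_sym in neq_vu.
    have := @card_edges_two_universal T G u v neq_vu
      (fun y => adj_of_ecc_le1 T_gt1 eu) (fun y => adj_of_ecc_le1 T_gt1 ev).
    by lia.
  rewrite (bigD1 u) //=; apply: leq_trans (leq_add (ecc_gt0 G u T_gt1) sum2).
  by rewrite sum2_but_one.
have sum2 : \sum_(x : T) 2 <= \sum_x ecc G x.
  by apply: leq_sum => x _; rewrite ltnNge ecc_gt1.
by apply: leq_trans sum2; rewrite sum_nat_const mulnC leq_subr.
Qed.

Section U1.
Set Implicit Arguments.
Unset Strict Implicit.
Variables (V : finType) (c a b : V).

Lemma U1_center x : x != c -> U1 c a b c x.
Proof.
by move=> neq_xc; rewrite /= /add_edge_adj /= /star_adj eq_sym neq_xc eqxx.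
Qed.

Lemma U1_connected : connected (U1 c a b).
Proof.
have to_c x : connect (U1 c a b) x c.
  have [->|neq_xc] := eqVneq x c; first exact: connect0.
  by apply: connect1; rewrite adj_sym U1_center.
apply/forallP => x; apply/forallP => y; apply: connect_trans (to_c x) _.
by rewrite (sym_connect_sym (adj_sym (U1 c a b))) to_c.
Qed.

Lemma edges_U1 : a != b ->
  edges (U1 c a b) = [set a; b] |: [set [set c; y] | y in [set~ c]].
Proof.
move=> neq_ab; apply/setP => e; rewrite !inE.
apply/edgesP/orP => [[x [y [Gxy ->]]] | [/eqP-> | /imsetP[y]]]; last first.
- by rewrite !inE => neq_yc ->; exists c, y; split; first exact: U1_center.
- exists a, b; split=> //.
  by rewrite /= /add_edge_adj neq_ab !eqxx orbT.
move: Gxy; rewrite /= /add_edge_adj /= /star_adj.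
case/orP=> /andP[neq_xy] /orP[].
- move/eqP=> xc; right; apply/imsetP; exists y; rewrite ?inE -?xc //.
  by rewrite eq_sym.
- move/eqP=> yc; right; apply/imsetP; exists x; rewrite ?inE -?yc //.
  by rewrite setUC.
- by case/andP=> /eqP-> /eqP->; left.
by case/andP=> /eqP-> /eqP->; left; rewrite setUC.
Qed.

Lemma card_edges_U1 : uniq [:: c; a; b] -> #|edges (U1 c a b)| = #|V|.
Proof.
rewrite /= !inE negb_or andbT => /andP[/andP[neq_ca neq_cb] neq_ab].
rewrite edges_U1 // cardsU1 card_star_edges ?inE ?eqxx // cardsC1.
have -> : [set a; b] \notin [set [set c; y] | y in [set~ c]].
  apply/imsetP => -[y _ /setP/(_ c)].
  by rewrite !inE eqxx (negPf neq_ca) (negPf neq_cb).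
by rewrite add1n prednK //; apply/card_gt0P; exists c.
Qed.

Lemma ecc_U1_center : 1 < #|V| -> ecc (U1 c a b) c <= 1.
Proof.
move=> V_gt1; apply/bigmax_leqP => y neq_yc.
by apply: dist_le => //; rewrite walk1 U1_center.
Qed.

Lemma ecc_U1 x : 2 < #|V| -> ecc (U1 c a b) x <= 2.
Proof.
move=> V_gt2.
have [->|neq_xc] := eqVneq x c; first by rewrite ltnW // ltnS ecc_U1_center // ltnW.
have Gxc : U1 c a b x c by rewrite adj_sym U1_center.
apply/bigmax_leqP => y _; have [->|neq_yc] := eqVneq y c.
  by apply: leqW; apply: dist_le; rewrite ?walk1 // ltnW.
by apply: dist_le => //; apply: walk2 Gxc _; apply: U1_center.
Qed.

Lemma total_ecc_U1 : 2 < #|V| -> total_ecc (U1 c a b) <= 2 * #|V| - 1.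
Proof.
move=> V_gt2; rewrite /total_ecc (bigD1 c) //=.
have sum2 : \sum_(x | x != c) ecc (U1 c a b) x <= \sum_(x | x != c) 2.
  by apply: leq_sum => x _; apply: ecc_U1.
apply: leq_trans (leq_add (ecc_U1_center (ltnW V_gt2)) sum2) _.
by rewrite sum2_but_one.
Qed.

End U1.

Theorem theorem3p1 (n : nat) (V : finType) (c a b : V) :
  4 <= n -> #|V| = n -> uniq [:: c; a; b] ->
  unicyclic (U1 c a b) n /\
  (forall (T : finType) (U : sgraph T),
     unicyclic U n -> total_ecc (U1 c a b) <= total_ecc U).
Proof.
move=> n_ge4 cV cab; split.
  by rewrite /unicyclic U1_connected card_edges_U1 // cV eqxx.
move=> T U /and3P[/eqP cT _ /eqP cE].
apply: leq_trans (total_ecc_U1 c a b _) _; first by rewrite cV ltnW.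
by rewrite cV -cT; apply: total_ecc_lower; rewrite ?cE cT.
Qed.
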